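(* Let $E/K$ be a Galois extension of number fields, $A=\mathfrak o_K$, $B=\mathfrak o_E$, let $C(X)\in A[X]$ be monic of degree $d\ge2$ with simple roots, with splitting field $E$ over $K$ and discriminant $\Delta_C$. For $n\in\mathbb N$ let $R_n(X)\in A[X]$ be the remainder of the Euclidean division of $X^n$ by $C(X)$. Let $\mathcal P$ be a nonzero prime ideal of $A$ not ramified in $B$ (in the sense $\Delta_C\notin\mathcal P$), and put $p=N(\mathcal P)$. Then $\mathcal P$ is totally split in $B$ if and only if $R_p(X)\equiv X \pmod{\mathcal P}$.
   Context: $N(\mathcal P)=|A/\mathcal P|$. A congruence of polynomials modulo $\mathcal P$ means that all coefficients of the difference lie in $\mathcal P$. The paper uses ''not ramified'' for a prime $\mathcal P$ of $A$ to mean that $\mathcal P$ is prime to $\Delta_C$, i.e. $\Delta_C\notin\mathcal P$. *)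

(* Defs.v *)
From HB Require Import structures.
From mathcomp Require Import all_boot all_order all_algebra all_field.
From mathcomp Require Import ring_quotient finmap.
From mathcomp Require Import boolp classical_sets cardinality.

Set Implicit Arguments.
Unset Strict Implicit.
Unset Printing Implicit Defensive.

Import GRing.Theory.
Local Open Scope ring_scope.

Section RingOfIntegers.
Variable L : fieldType.

Definition is_algint : {pred L} :=
  fun x => `[< integralOver (intr : int -> L) x >].

Fact is_algint_subring_closed : subring_closed is_algint.
Proof.
split=> [|x y /asboolP xP /asboolP yP|x y /asboolP xP /asboolP yP].
- by apply/asboolP; apply: (integral1 (intr : {rmorphism int -> L})).
- by apply/asboolP; apply: integral_sub.
- by apply/asboolP; apply: integral_mul.
Qed.

HB.instance Definition _ :=
  GRing.isSubringClosed.Build L is_algint is_algint_subring_closed.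

Record ringOfInt := RingOfInt { algint_val : L; _ : algint_val \in is_algint }.

HB.instance Definition _ := [isSub for algint_val].
HB.instance Definition _ := [Choice of ringOfInt by <:].
HB.instance Definition _ := [SubChoice_isSubComNzRing of ringOfInt by <:].

End RingOfIntegers.

Section Inclusion.
Variables (K : fieldType) (E : fieldExtType K).

Fact algint_incl_subproof (x : ringOfInt K) :
  (\val x)%:A \in @is_algint E.
Proof.
case: x => x /= /asboolP[p p_monic px0]; apply/asboolP; exists p => //.
have -> : map_poly (intr : int -> E) p
    = map_poly (in_alg E) (map_poly (intr : int -> K) p).
  rewrite -map_poly_comp; apply: eq_map_poly => z.
  exact/esym/(rmorph_int (in_alg E)).
exact: (rmorph_root (in_alg E)).
Qed.

Definition algint_incl (x : ringOfInt K) : ringOfInt E :=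
  RingOfInt (algint_incl_subproof x).

Definition algint_poly_incl (f : {poly ringOfInt K}) : {poly E} :=
  map_poly (fun x : ringOfInt K => (\val x)%:A) f.

End Inclusion.

Arguments algint_incl {K} E x.
Arguments algint_poly_incl {K} E f.

Section Ideals.
Variable R : comNzRingType.

Definition ideal_gen (S : set R) : set R :=
  [set x | exists (k : nat) (a s : 'I_k -> R),
      (forall i, S (s i)) /\ x = \sum_(i < k) a i * s i]%classic.

Definition ideal_prod (n : nat) (I : 'I_n -> set R) : set R :=
  ideal_gen [set x | exists y : 'I_n -> R,
      (forall i, I i (y i)) /\ x = \prod_(i < n) y i]%classic.

(* N(I) = |R / I|; fset_set sends an infinite set to fset0, so the value is 0
   when the quotient is infinite. *)
Definition ideal_norm (I : idealr R) : nat :=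
  #|` fset_set [set: {ideal_quot I}]%classic |.

Definition poly_cong (I : idealr R) (f g : {poly R}) : Prop :=
  forall i, (f - g)`_i \in I.

(* The usual formula for monic C.  resultant is the determinant of the Sylvester
   matrix with coefficients in increasing order; this differs from the usual one
   by the sign (-1) ^ (deg C * deg C^`()), which is 1 when
   deg C^`() = deg C - 1. *)
Definition poly_disc (C : {poly R}) : R :=
  (-1) ^+ 'C((size C).-1, 2) * resultant C C^`().

(* Pdiv.Ring.rmodp is pseudo-division, which is Euclidean division when C is
   monic (Pdiv.RingMonic.rdivp_eq). *)
Definition X_pow_rem (C : {poly R}) (n : nat) : {poly R} :=
  Pdiv.Ring.rmodp 'X^n C.

End Ideals.

Definition ideal_ext (K : fieldType) (E : fieldExtType K)
    (I : idealr (ringOfInt K)) : set (ringOfInt E) :=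
  ideal_gen (algint_incl E @` [set x | x \in I])%classic.

Arguments ideal_ext {K} E I.

(* P B is the product of [E : K] pairwise distinct prime ideals of B. *)
Definition totally_split (K : fieldType) (E : fieldExtType K)
    (P : idealr (ringOfInt K)) : Prop :=
  exists Q : 'I_(\dim {:E}) -> prime_idealr (ringOfInt E),
    (forall i j, i != j -> ~ (Q i =i Q j)) /\
    ideal_ext E P = ideal_prod (fun i => [set x | x \in Q i]%classic).

Arguments totally_split {K} E P.

(* Main.v *)
(** Write [B] for the integers of [E], [G] for the Galois group, and let [Q] be
    a prime of [B] over [P].  Both conditions say that the stabilizer of [Q] in
    [G] is trivial.

    The primes over [P] are the [G]-conjugates of [Q], and there are [[E : K]] of
    them exactly when the stabilizer is trivial.  In that case some [c] outside
    [Q] lies in all the other conjugates; taking traces of multiples of [c]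
    shows [A/P = B/Q], and the discriminant of the conjugates of [c] is prime to
    [P], which gives [PB] as the product of the conjugates of [Q].

    Since the discriminant of [C] is not in [P], the roots of [C] are distinct
    modulo [Q], so [R_p = X] modulo [P] means that every root [x] satisfies
    [x ^ p = x] modulo [Q], i.e. lies in [A/P].  This follows from [A/P = B/Q];
    conversely an automorphism that preserves [Q] then fixes all the roots modulo
    [Q], hence fixes them, hence is trivial. *)

From HB Require Import structures.
Require Import Defs.
From mathcomp Require Import all_boot all_order all_fingroup all_algebra all_field.
From mathcomp Require Import generic_quotient ring_quotient finmap.
From mathcomp Require Import boolp classical_sets cardinality.
From mathcomp Require Import ring.

Set Implicit Arguments.
Unset Strict Implicit.
Unset Printing Implicit Defensive.

Import GRing.Theory.
Local Open Scope ring_scope.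
Local Open Scope quotient_scope.

(** * Quotients by prime ideals and generated ideals *)

Lemma quot_pi_eq0 (R : comNzRingType) (I : idealr R) (x : R) :
  (\pi_{ideal_quot I} x == 0) = (x \in I).
Proof. by rewrite -[0](rmorph0 (\pi_{ideal_quot I})) -Quotient.idealrBE subr0. Qed.

(** Each root splits off a monic linear factor. The zero-product property is a hypothesis on a bare
    ring, to be supplied by quotients by primes. *)
Lemma domain_max_poly_roots (R : comNzRingType)
    (domR : forall x y : R, x * y = 0 -> (x == 0) || (y == 0))
    (p : {poly R}) (rs : seq R) :
  p != 0 -> all (root p) rs -> uniq rs -> (size rs < size p)%N.
Proof.
elim: rs p => [p p0 _ _ | r rs IHrs p p0] /=; first by rewrite size_poly_gt0.
case/andP=> /factor_theorem[q Dp] rs_p /andP[rNrs Urs].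
have q0 : q != 0 by apply: contraNneq p0 => q0; rewrite Dp q0 mul0r.
rewrite Dp size_Mmonic ?monicXsubC // size_XsubC addn2 ltnS; apply: IHrs => //.
apply/allP=> s s_rs; have /rootP := allP rs_p s s_rs.
rewrite Dp hornerM hornerXsubC => /domR/orP[// | ].
by rewrite subr_eq0 => /eqP sr; rewrite -sr s_rs in rNrs.
Qed.

Lemma quot_max_poly_roots (R : comNzRingType) (P : prime_idealr R)
    (p : {poly {ideal_quot P}}) rs :
  p != 0 -> all (root p) rs -> uniq rs -> (size rs < size p)%N.
Proof. exact/domain_max_poly_roots/Quotient.rquot_IdomainAxiom. Qed.

Section IdealGen.
Variables (R : comNzRingType) (S : set R).

Lemma ideal_gen_incl x : S x -> ideal_gen S x.
Proof.
by move=> Sx; exists 1%N, (fun=> 1), (fun=> x); rewrite big_ord1 mul1r.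
Qed.

Lemma ideal_gen0 : ideal_gen S 0.
Proof.
have F : 'I_0 -> R by case.
by exists 0%N, F, F; rewrite big_ord0; split=> [[]|].
Qed.

Lemma ideal_genD x y : ideal_gen S x -> ideal_gen S y -> ideal_gen S (x + y).
Proof.
case=> [k [a [s [Ss ->]]]] [l [b [t [St ->]]]].
exists (k + l)%N, (fun i => match split i with inl i => a i | inr i => b i end),
  (fun i => match split i with inl i => s i | inr i => t i end).
split=> [i|]; first by case: (split i).
rewrite big_split_ord; congr (_ + _); apply: eq_bigr => i _ /=.
  by rewrite (unsplitK (inl i)).
by rewrite (unsplitK (inr i)).
Qed.

Lemma ideal_genM a x : ideal_gen S x -> ideal_gen S (a * x).
Proof.
case=> [k [b [s [Ss ->]]]]; exists k, (fun i => a * b i), s; split=> //.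
by rewrite mulr_sumr; apply: eq_bigr => i _; rewrite mulrA.
Qed.

Lemma ideal_gen_sum (I : Type) (r : seq I) (T : pred I) (F : I -> R) :
  (forall i, T i -> ideal_gen S (F i)) -> ideal_gen S (\sum_(i <- r | T i) F i).
Proof.
by move=> SF; elim/big_rec: _ => [|i x Ti]; [exact: ideal_gen0 | exact/ideal_genD/SF].
Qed.

Lemma ideal_gen_sub (I : idealr R) x :
  (forall y, S y -> y \in I) -> ideal_gen S x -> x \in I.
Proof.
move=> SI [k [a [s [Ss ->]]]]; apply: rpred_sum => i _.
exact/idealMr/SI/Ss.
Qed.

End IdealGen.

(** Packages a predicate that is only constructed inside a proof, such as a Zorn maximum or a
    conjugate of a prime. *)
Lemma prime_idealr_of_pred (R : comNzRingType) (J : pred R) :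
  idealr_closed J -> prime_idealr_closed J ->
  exists Q : prime_idealr R, forall x, (x \in Q) = J x.
Proof.
move=> idJ prJ; pose idJm := isIdealr.Build R J idJ.
pose prJm := isPrimeIdealrClosed.Build R J prJ.
pose Q : prime_idealr R := HB.pack J idJm prJm.
by exists Q.
Qed.

(** * Finite group actions and primes over a prime of the invariant ring *)

Section InvariantRing.
Variables (A B : comNzRingType) (f : {rmorphism A -> B}).
Variables (G : finGroupType) (act : G -> {rmorphism B -> B}).
Hypothesis act1 : forall b, act 1%g b = b.
Hypothesis actM : forall g h b, act (g * h)%g b = act h (act g b).
Hypothesis act_f : forall g a, act g (f a) = f a.
Hypothesis act_fixed : forall b, (forall g, act g b = b) -> exists a, b = f a.

Lemma actK g b : act g (act g^-1%g b) = b.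
Proof. by rewrite -actM mulVg act1. Qed.

Lemma actVK g b : act g^-1%g (act g b) = b.
Proof. by rewrite -actM mulgV act1. Qed.

Lemma trace_lift b : exists a, \sum_g act g b = f a.
Proof.
apply: act_fixed => h; rewrite rmorph_sum [RHS](reindex_inj (mulIg h)) /=.
by apply: eq_bigr => g _; rewrite actM.
Qed.

(** The coefficients of the orbit polynomial of [b] are invariant, hence come from [A]; this is the
    integrality of [B] over [A]. *)
Lemma orbit_poly_lift b :
  exists F : {poly A}, map_poly f F = \prod_g ('X - (act g b)%:P).
Proof.
set p := \prod_g _.
have p_fix g : map_poly (act g) p = p.
  rewrite rmorph_prod [RHS](reindex_inj (mulIg g)) /=; apply: eq_bigr => h _.
  by rewrite rmorphB /= map_polyX map_polyC /= actM.
have /choice[a Da] i : exists a, p`_i = f a.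
  by apply: act_fixed => g; rewrite -[in RHS](p_fix g) coef_map.
exists (\poly_(i < size p) a i); apply/polyP=> i; rewrite coef_map coef_poly.
by case: ltnP => [_ | /(nth_default 0) ->]; [rewrite Da | exact: rmorph0].
Qed.

Lemma size_orbit_poly b : size (\prod_g ('X - (act g b)%:P)) = #|G|.+1.
Proof. by rewrite size_prod_XsubC cardT enumT [index_enum G]unlock. Qed.

Lemma root_orbit_poly b : (\prod_g ('X - (act g b)%:P)).[b] = 0.
Proof.
by rewrite (bigD1 1%g) //= hornerM hornerXsubC act1 subrr mul0r.
Qed.

Section OverPrime.
Variable P : prime_idealr A.

(** Modulo [Q] the orbit polynomial of [b] is a power of X, so its lower coefficients lie in [P];
    its vanishing at [b] then puts a power of [b] in [Q']. *)
Lemma mem_over_of_orbit (Q Q' : prime_idealr B)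
    (QP : forall a, (f a \in Q) = (a \in P))
    (Q'P : forall a, (f a \in Q') = (a \in P)) b : (forall g, act g b \in Q) -> b \in Q'.
Proof.
move=> bQ; have [F DF] := orbit_poly_lift b.
have FP i : (i < #|G|)%N -> F`_i \in P.
  move=> ltin; rewrite -QP -quot_pi_eq0 -coef_map DF.
  rewrite -[X in X == 0](coef_map (\pi_{ideal_quot Q})) rmorph_prod /=.
  rewrite (eq_bigr (fun=> 'X)) => [|g _].
    by rewrite prodr_const coefXn ltn_eqF.
  rewrite rmorphB /= map_polyX map_polyC /=.
  by have := bQ g; rewrite -quot_pi_eq0 => /eqP ->; rewrite subr0.
have := root_orbit_poly b; rewrite horner_coef size_orbit_poly big_ord_recr /=.
have -> : (\prod_g ('X - (act g b)%:P))`_#|G| = 1.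
  have /monicP := @monic_prod_XsubC _ _ (index_enum G) xpredT (fun g => act g b).
  by rewrite /lead_coef size_orbit_poly.
rewrite mul1r => /eqP; rewrite addrC addr_eq0 => /eqP bn.
have : b ^+ #|G| \in Q'.
  rewrite bn rpredN; apply: rpred_sum => i _; rewrite mulrC idealMr //.
  by rewrite -DF coef_map Q'P FP.
elim: #|G| => [|n IHn]; first by rewrite expr0 idealr1.
by rewrite exprS prime_idealrM => /orP[].
Qed.

(** The inverse of [g] is a power of [g], so a one-sided inclusion is an equality. *)
Lemma act_sub_eq (Q : prime_idealr B) g :
  (forall x, x \in Q -> act g x \in Q) -> forall x, (act g x \in Q) = (x \in Q).
Proof.
move=> gQ x; apply/idP/idP; last exact: gQ.
have gkQ k y : y \in Q -> act (g ^+ k)%g y \in Q.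
  elim: k y => [|k IHk] y yQ; first by rewrite expg0 act1.
  by rewrite expgS actM; apply/IHk/gQ.
by move/(gkQ #[g]%g.-1); rewrite -actM -expgS prednK ?order_gt0 // expg_order act1.
Qed.

(** Otherwise each [g] sends into [Q] some [y g] outside [Q']; the product of these has all its
    conjugates in [Q] but is not in [Q']. *)
Lemma primes_over_conj_sub (Q Q' : prime_idealr B)
    (QP : forall a, (f a \in Q) = (a \in P))
    (Q'P : forall a, (f a \in Q') = (a \in P)) :
  exists g, forall x, act g x \in Q -> x \in Q'.
Proof.
apply: contrapT => noQ.
have /choice[y yP] g : exists y, act g y \in Q /\ y \notin Q'.
  apply: contrapT => noy; apply: noQ; exists g => x xQ.
  by apply/negPn/negP => xQ'; apply: noy; exists x.
have : \prod_g y g \in Q'.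
  apply: (mem_over_of_orbit QP Q'P) => g; rewrite rmorph_prod (bigD1 g) //=.
  by rewrite mulrC idealMr // (yP g).1.
elim/big_rec: _ => [|g x _ IHx]; first by rewrite idealr1.
by rewrite prime_idealrM (negbTE (yP g).2).
Qed.

(** Inclusions in both directions compose to a stability of [Q'], which finite order turns into an
    equality. *)
Lemma primes_over_conj (Q Q' : prime_idealr B)
    (QP : forall a, (f a \in Q) = (a \in P))
    (Q'P : forall a, (f a \in Q') = (a \in P)) :
  exists g, forall x, (x \in Q') = (act g x \in Q).
Proof.
have [g gQ] := primes_over_conj_sub QP Q'P.
have [h hQ] := primes_over_conj_sub Q'P QP.
exists g => x; apply/idP/idP=> [xQ' | /gQ //]; apply: (hQ); rewrite -actM.
rewrite -(@act_sub_eq _ (g * h)^-1%g) ?actVK // => z zQ'.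
by apply/gQ/hQ; rewrite -actM actK.
Qed.

(* Every ideal of B maximal among those that contract into P is prime, and
   integrality forces it to contract onto P. *)
Lemma lying_over (f_inj : injective f) :
  exists Q : prime_idealr B, forall a, (f a \in Q) = (a \in P).
Proof.
(* The empty set belongs to [D], being the union of the empty chain; that a maximal [J] contains 0
   is shown separately. *)
pose D := [set X : set B | [/\ forall x y, X x -> X y -> X (x + y),
  forall b x, X x -> X (b * x) & forall a, X (f a) -> a \in P]]%classic.
have [|J [[JD JM JP] Jmax]] := @Zorn_bigcup _ D.
  move=> F FD Ftot; split=> [x y [X FX Xx] [Y FY Yy] | b x [X FX Xx] | a [X FX Xa]].
  - have [XY | YX] := Ftot X Y FX FY.
      by exists Y => //; have [YD _ _] := FD _ FY; apply: YD => //; apply: XY.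
    by exists X => //; have [XD _ _] := FD _ FX; apply: XD => //; apply: YX.
  - by exists X => //; have [_ XM _] := FD _ FX; apply: XM.
  - by have [_ _ XP] := FD _ FX; apply: XP.
have J0 : J 0.
  apply: contrapT => nJ0.
  have Jempty x : ~ J x by move=> /(JM 0); rewrite mul0r.
  apply: (Jmax [set 0]%classic).
    by split=> [x /Jempty [] | /(_ 0 erefl)/nJ0].
  split=> [x y -> -> | b x -> | a fa0].
  - by rewrite /= addr0.
  - by rewrite /= mulr0.
  - by have -> : a = 0 by [apply: f_inj; rewrite fa0 rmorph0]; exact: idealr0.
(* By maximality the ideal [J + xB] contains some [f s] with [s] outside [P]. *)
have escape x : ~ J x -> exists s b, s \notin P /\ J (f s - x * b).
  move=> nJx; apply: contrapT => noS.
  apply: (Jmax [set z | exists b, J (z - x * b)]%classic).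
    split=> [z Jz | /(_ x) sub]; first by exists 0; rewrite mulr0 subr0.
    by apply: nJx; apply: sub; exists 1; rewrite mulr1 subrr.
  split=> [z z' [b Jb] [b' Jb'] | a z [b Jb] | a [b Jb]].
  - exists (b + b'); have := JD _ _ Jb Jb'; congr J; ring.
  - exists (a * b); have := JM a _ Jb; congr J; ring.
  - by apply/negPn/negP => aP; apply: noS; exists a, b.
have JN x : J x -> J (- x) by move=> /(JM (-1)); rewrite mulN1r.
have JB x y : J x -> J y -> J (x - y) by move=> Jx /JN; apply: JD.
have [||Q QJ] := @prime_idealr_of_pred _ (fun x => `[< J x >]).
- split; first exact/asboolP.
    apply/negP=> /asboolP J1; have := JP 1; rewrite rmorph1 => /(_ J1).
    by rewrite idealr1.
  move=> a u v /asboolP Ju /asboolP Jv; apply/asboolP.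
  by apply: JD => //; apply: JM.
- move=> u v /asboolP Juv; apply/orP; apply: contrapT => nJ.
  have /escape[s [b [sP Js]]] : ~ J u.
    by move=> Ju; apply: nJ; left; apply/asboolP.
  have /escape[t [b' [tP Jt]]] : ~ J v.
    by move=> Jv; apply: nJ; right; apply/asboolP.
  have : s * t \in P.
    apply: JP; have -> : f (s * t) = (b * b') * (u * v) + f t * (f s - u * b)
        + u * b * (f t - v * b') by rewrite rmorphM; ring.
    by apply: (JD); [apply: (JD)|]; apply: JM.
  by rewrite prime_idealrM (negbTE sP) (negbTE tP).
exists Q => a; rewrite QJ; apply/asboolP/idP => [/JP // | aP].
apply: contrapT => /escape[s [b [sP Js]]].
have [F DF] := orbit_poly_lift b.
(* Homogenized orbit polynomial: replacing [f s] by [f a * b] modulo [J] turns [f N] into a multiple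
   of its value at [b], which is 0. As [a] is in [P], only the term [s ^+ #|G|] survives modulo
   [P]. *)
pose N := \sum_(i < #|G|.+1) F`_i * a ^+ (#|G| - i) * s ^+ i.
have JX i : J (f s ^+ i - (f a * b) ^+ i).
  by rewrite subrXX mulrC; apply: JM.
have : N \in P.
  apply: JP.
  have -> : f N = \sum_(i < #|G|.+1) f (F`_i * a ^+ (#|G| - i)) *
                    (f s ^+ i - (f a * b) ^+ i).
    rewrite rmorph_sum /=.
    under [RHS]eq_bigr => i _ do rewrite mulrBr.
    rewrite sumrB -[LHS]subr0; congr (_ - _).
      by apply: eq_bigr => i _; rewrite rmorphM rmorphXn.
    have := root_orbit_poly b; rewrite horner_coef size_orbit_poly => Fb0.
    have := congr1 ( *%R (f a ^+ #|G|)) Fb0; rewrite mulr0 mulr_sumr => aFb0.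
    rewrite -[LHS]aFb0; apply: eq_bigr => i _.
    rewrite -DF coef_map rmorphM rmorphXn exprMn /=.
    rewrite -{1}(subnK (leq_ord i)) exprD; ring.
  by elim/big_rec: _ => // i x _ Jx; apply: JD => //; apply: JM.
rewrite /N big_ord_recr /= subnn expr0 mulr1 rpredDl; last first.
  apply: rpred_sum => i _; rewrite mulrAC idealMr //.
  have := ltn_ord i; rewrite -subn_gt0; case: (#|G| - i)%N => // k _.
  by rewrite exprSr idealMr.
have -> : F`_#|G| = 1.
  apply: f_inj; rewrite rmorph1 -coef_map DF.
  have /monicP := @monic_prod_XsubC _ _ (index_enum G) xpredT (fun g => act g b).
  by rewrite /lead_coef size_orbit_poly.
rewrite mul1r; elim: #|G| => [|k IHk]; first by rewrite expr0 idealr1.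
by rewrite exprS prime_idealrM (negbTE sP).
Qed.

(** * Primes with trivial stabilizer *)

Section TrivialStabilizer.
Hypothesis P_max : forall a, a \notin P -> exists a', a * a' - 1 \in P.
Variable Q : prime_idealr B.
Hypothesis QP : forall a, (f a \in Q) = (a \in P).
Hypothesis stabQ : forall g, (forall x, x \in Q -> act g x \in Q) -> g = 1%g.

(** If every [y] that [g] sends into [Q] were in [Q], the inverse of [g] would preserve [Q]. *)
Lemma separating_family : exists d : G -> B,
  (forall g, g != 1%g -> act g (d g) \in Q) /\ forall g, d g \notin Q.
Proof.
suff /choice[d dP] g : exists y, (g != 1%g -> act g y \in Q) /\ y \notin Q.
  by exists d; split=> g; [exact: (dP g).1 | exact: (dP g).2].
have [-> | g1] := eqVneq g 1%g; first by exists 1; rewrite idealr1.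
apply: contrapT => noy; have /stabQ/eqP : forall x, x \in Q -> act g^-1%g x \in Q.
  move=> x xQ; apply/negPn/negP => gx; apply: noy.
  by exists (act g^-1%g x); rewrite actK xQ.
by rewrite invg_eq1 (negbTE g1).
Qed.

(** For a separating family [d] this is outside [Q], while every nontrivial [g] sends it into [Q]
    through the factor [d g]. Modulo [Q] the trace of a multiple of it is thus that multiple. *)
Let c (d : G -> B) := \prod_(g | g != 1%g) d g.

Lemma separator_notin d : (forall g, d g \notin Q) -> c d \notin Q.
Proof.
move=> dQ; rewrite /c; elim/big_rec: _ => [|g x _]; first by rewrite idealr1.
by rewrite prime_idealrM negb_or dQ.
Qed.

Lemma act_separator d g :
  (forall g, g != 1%g -> act g (d g) \in Q) -> g != 1%g -> act g (c d) \in Q.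
Proof.
move=> dQ g1; rewrite /c rmorph_prod (bigD1 g) //= mulrC idealMr //.
exact: dQ.
Qed.

Lemma trace_separator d b : (forall g, g != 1%g -> act g (d g) \in Q) ->
  \sum_g act g (c d * b) - c d * b \in Q.
Proof.
move=> dQ; rewrite (bigD1 1%g) //= act1 addrAC subrr add0r.
apply: rpred_sum => g g1; rewrite rmorphM /= mulrC idealMr //.
exact: act_separator.
Qed.

Lemma trace_separator_notin d t :
    (forall g, g != 1%g -> act g (d g) \in Q) -> (forall g, d g \notin Q) ->
  \sum_g act g (c d) = f t -> t \notin P.
Proof.
move=> dQ dNQ Dt; rewrite -QP; apply: contra (separator_notin dNQ) => ftQ.
have := trace_separator 1 dQ; rewrite mulr1 Dt => tQ.
by rewrite -[c d](subKr (f t)) rpredB.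
Qed.

(** Modulo [Q] the traces of [c d] and [c d * b] are these elements themselves, so [b] is a quotient
    of two elements of [A] with denominator invertible modulo [P]. *)
Lemma residue_lift b : exists a, b - f a \in Q.
Proof.
have [d [dQ dNQ]] := separating_family.
have [t Dt] := trace_lift (c d); have tP := trace_separator_notin dQ dNQ Dt.
have [s Ds] := trace_lift (c d * b); have [t' t'P] := P_max tP.
have tb : f t * b - f s \in Q.
  have := trace_separator b dQ; rewrite Ds => sQ.
  have := trace_separator 1 dQ; rewrite mulr1 Dt => tQ.
  rewrite -(subrKA (c d * b)) rpredD //.
    by rewrite -mulrBl mulrC idealMr.
  by rewrite -opprB rpredN.
exists (t' * s).
have -> : b - f (t' * s) = f t' * (f t * b - f s) - b * f (t * t' - 1).
  by rewrite rmorphB !rmorphM /= rmorph1; ring.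
by rewrite rpredB // idealMr // QP.
Qed.

Variables (n : nat) (h : 'I_n -> G).
Hypothesis h_bij : bijective h.

Let conjQ i : set B := [set x | act (h i) x \in Q]%classic.

Lemma ideal_prod_conj (y : G -> B) :
  (forall g, act g (y g) \in Q) -> ideal_prod conjQ (\prod_g y g).
Proof.
move=> yQ; apply: ideal_gen_incl; exists (y \o h); split=> [i|]; first exact: yQ.
by rewrite (reindex h) //; apply: onW_bij.
Qed.

Lemma orbit_sub_ideal_prod x :
  (forall g, act g x \in Q) -> ideal_prod conjQ x.
Proof.
move=> xQ; have [d [dQ dNQ]] := separating_family.
have [t Dt] := trace_lift (c d); have tP := trace_separator_notin dQ dNQ Dt.
have [t' t'P] := P_max tP.
have tx : ideal_prod conjQ (f t * x).
  rewrite -Dt mulr_suml; apply: ideal_gen_sum => g _.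
  (* The factor [y k] lies in the conjugate of index [k]: [x] fills the slot of the inverse of [g],
     and in the others [act (g * k)] sends [d (g * k)] into [Q]. *)
  pose y k := if (g * k == 1)%g then x else act g (d (g * k)%g).
  suff -> : act g (c d) * x = \prod_k y k.
    apply: ideal_prod_conj => k; rewrite /y; case: eqP => [_ // | /eqP gk1].
    by rewrite -actM dQ.
  rewrite (reindex_inj (mulgI g^-1%g)) /= (bigD1 1%g) //= mulrC rmorph_prod.
  rewrite /y mulg1 mulgV eqxx; congr (_ * _); apply: eq_bigr => k k1.
  by rewrite mulKVg (negbTE k1).
(* The geometric sum gives [1 = f (t * t') * S + z ^+ #|G|], and the [#|G|] copies of [z], the image
   of an element of [P], fill one slot each. *)
pose z := f (1 - t * t'); pose S := \sum_(i < #|G|) z ^+ i.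
have -> : x = f t' * S * (f t * x) + x * z ^+ #|G|.
  rewrite -[x in LHS]mulr1 -[1 in LHS](subKr (z ^+ #|G|)) subrX1 mulrBr addrC.
  by rewrite -/S /z rmorphB rmorph1 rmorphM /=; ring.
apply: ideal_genD; first exact: ideal_genM.
apply: ideal_genM; rewrite -prodr_const.
by apply: ideal_prod_conj => g; rewrite act_f QP -opprB rpredN.
Qed.

(* The traces Tr(x b) for b in the conjugates of the separator c lie in P;
   Cramer's rule recovers x from them up to the discriminant e of these
   conjugates, which is a power of c modulo Q. *)
Lemma orbit_sub_ideal_ext x :
  (forall g, act g x \in Q) -> ideal_gen (f @` [set a | a \in P])%classic x.
Proof.
move=> xQ; have [d [dQ dNQ]] := separating_family.
have [hi hK hiK] := h_bij.
(* With this choice [T] has [c d] on the diagonal and elements of [Q] elsewhere, so it is scalar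
   modulo [Q]. *)
pose b j := act (h j)^-1%g (c d).
pose T : 'M[B]_n := \matrix_(i, j) act (h i) (b j).
have /choice[m Dm] jk : exists a, \sum_g act g (b jk.1 * b jk.2) = f a.
  exact: trace_lift.
have /choice[s Ds] j : exists a, \sum_g act g (x * b j) = f a.
  exact: trace_lift.
pose M : 'M[A]_n := \matrix_(j, k) m (j, k).
pose y : 'rV[A]_n := \row_j s j.
pose u : 'rV[B]_n := \row_i act (h i) x.
have DM : T^T *m T = map_mx f M.
  apply/matrixP=> j k; rewrite !mxE -Dm (reindex h) /=; last exact: onW_bij.
  by apply: eq_bigr => i _; rewrite !mxE rmorphM.
have Dy : u *m T = map_mx f y.
  apply/matrixP=> j k; rewrite !mxE -Ds (reindex h) /=; last exact: onW_bij.
  by apply: eq_bigr => i _; rewrite !mxE rmorphM.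
have yP j : y 0 j \in P.
  rewrite mxE -QP -Ds; apply: rpred_sum => g _.
  by rewrite rmorphM mulrC idealMr.
pose e := \det M.
have De : f e = \det T ^+ 2 by rewrite -det_map_mx -DM det_mulmx det_tr.
have eP : e \notin P.
  rewrite -QP De -quot_pi_eq0 rmorphXn /= -det_map_mx.
  have -> : map_mx \pi_{ideal_quot Q} T = (\pi_{ideal_quot Q} (c d))%:M.
    apply/matrixP=> i j; rewrite !mxE -actM; have [-> | ij] := eqVneq i j.
      by rewrite mulVg act1 mulr1n.
    rewrite mulr0n; apply/eqP; rewrite quot_pi_eq0; apply: act_separator => //.
    by rewrite -eq_mulVg1 eq_sym; apply: contra ij => /eqP/(can_inj hK)->.
  rewrite det_scalar -exprM -rmorphXn /= quot_pi_eq0.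
  elim: (n * 2)%N => [|k IHk]; first by rewrite idealr1.
  by rewrite exprS prime_idealrM negb_or separator_notin.
have [e' e'P] := P_max eP.
pose W := map_mx f (y *m \adj M) *m T^T.
have WT : W *m T = f e *: (u *m T).
  rewrite Dy -mulmxA DM -map_mxM -mulmxA mul_adj_mx mul_mx_scalar.
  by rewrite map_mxZ.
have DW : \det T *: W = (f e * \det T) *: u.
  have := congr1 (mulmx^~ (\adj T)) WT => /=.
  by rewrite -scalemxAl -!(mulmxA _ T) mul_mx_adj !mul_mx_scalar scalerA.
(* Multiplying once more by [\det T] turns it into [f e], which avoids a cancellation in [B]; the
   entry of [u] at [hi 1] is [x]. *)
have fex : f (e ^+ 2) * x = f e * W 0 (hi 1%g).
  have : f e *: W = f (e ^+ 2) *: u.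
    rewrite {1}De expr2 -scalerA DW scalerA mulrCA -expr2 -De -expr2.
    by rewrite -rmorphXn.
  by move/matrixP/(_ 0 (hi 1%g)); rewrite !mxE hiK act1.
(* The product [e * e'] is 1 modulo [P], so the second term lies in [PB]; the first does because [W]
   is built from [y], whose entries are in [P]. *)
have -> : x = f (e' ^+ 2) * (f e * W 0 (hi 1%g)) + x * f (1 - (e * e') ^+ 2).
  by rewrite -fex rmorphB !rmorphXn rmorph1 rmorphM /=; ring.
apply: ideal_genD; apply: ideal_genM.
  apply: ideal_genM; rewrite mxE; apply: ideal_gen_sum => j _.
  rewrite mulrC; apply/ideal_genM/ideal_gen_incl.
  exists ((y *m \adj M) 0 j); last by rewrite [RHS]mxE.
  by rewrite /= mxE; apply: rpred_sum => k _; rewrite mulrC idealMr.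
apply: ideal_gen_incl; exists (1 - (e * e') ^+ 2) => //=.
by rewrite -opprB rpredN subrX1 mulrC idealMr.
Qed.

End TrivialStabilizer.
End OverPrime.
End InvariantRing.

(** * Finite residue rings *)

Section FiniteDomain.
Variables (R : comNzRingType) (s : seq R).
Hypothesis domR : forall x y : R, x * y = 0 -> (x == 0) || (y == 0).
Hypotheses (s_uniq : uniq s) (s_full : forall x, x \in s).

(** For nonzero [x], multiplication by [x] permutes the nonzero elements, and their product can be
    cancelled. *)
Lemma finite_domain_expf_card (x : R) : x ^+ size s = x.
Proof.
have s_gt0 : (0 < size s)%N by case: s (s_full 0).
have [-> | x0] := eqVneq x 0; first by rewrite expr0n eqn0Ngt s_gt0.
have xI : injective ( *%R x).
  move=> y z /eqP; rewrite -subr_eq0 -mulrBr => /eqP/domR.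
  by rewrite (negbTE x0) subr_eq0 => /eqP.
pose r := [seq y <- s | y != 0].
have r_perm : perm_eq (map ( *%R x) r) r.
  have r_uniq : uniq (map ( *%R x) r) by rewrite map_inj_uniq ?filter_uniq.
  have sub_r : {subset map ( *%R x) r <= r}.
    move=> _ /mapP[y + ->]; rewrite !mem_filter !s_full !andbT.
    by apply: contra => /eqP/domR; rewrite (negbTE x0).
  apply: uniq_perm; rewrite ?filter_uniq //.
  by have [|_] := uniq_min_size r_uniq sub_r; rewrite ?size_map.
have r_size : size s = (size r).+1.
  rewrite size_filter -(count_predC (pred1 0) s) count_uniq_mem // s_full.
  by rewrite add1n; congr _.+1; apply: eq_count.
have r_prod : \prod_(y <- r) y != 0.
  have : all (fun y => y != 0) r by rewrite filter_all.
  elim: r {r_perm r_size} => [|y r IHr] /=; first by rewrite big_nil oner_neq0.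
  case/andP=> y0 /IHr r0; rewrite big_cons.
  by apply: contra y0 => /eqP/domR/orP[// | ]; rewrite (negbTE r0).
have : (x ^+ size r - 1) * \prod_(y <- r) y = 0.
  rewrite mulrBl mul1r -[X in _ - X](perm_big _ r_perm) /= big_map big_split /=.
  by rewrite big_const_seq count_predT -Monoid.iteropE subrr.
move/domR; rewrite (negbTE r_prod) orbF subr_eq0 => /eqP xr.
by rewrite r_size exprS xr mulr1.
Qed.

Lemma finite_domain_inv (x : R) : x != 0 -> exists y, x * y = 1.
Proof.
move=> x0; have := finite_domain_expf_card x.
have : (1 < size s)%N.
  apply: (@uniq_leq_size _ [:: 0; 1]); first by rewrite /= inE eq_sym oner_neq0.
  by move=> y _.
case: (size s) => [|[|m]] // _ /eqP.
rewrite -subr_eq0 exprS -[X in _ - X]mulr1 -mulrBr => /eqP/domR.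
by rewrite (negbTE x0) subr_eq0 => /eqP xm; exists (x ^+ m); rewrite -exprS.
Qed.

End FiniteDomain.

Section IdealNorm.
Variables (R : comNzRingType) (P : prime_idealr R).
Hypothesis P_fin : finite_set [set: {ideal_quot P}]%classic.

Let s : seq {ideal_quot P} := fset_set [set: {ideal_quot P}]%classic.

Let s_full x : x \in s. Proof. by rewrite in_fset_set // inE. Qed.

Lemma quot_expf_norm (x : R) : x ^+ ideal_norm P - x \in P.
Proof.
rewrite -quot_pi_eq0 rmorphB rmorphXn subr_eq0.
rewrite (@finite_domain_expf_card _ s) ?fset_uniq //.
exact: Quotient.rquot_IdomainAxiom.
Qed.

Lemma quot_field a : a \notin P -> exists a', a * a' - 1 \in P.
Proof.
rewrite -quot_pi_eq0 => /(@finite_domain_inv _ s).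
case=> [||//|y ay1]; [exact: Quotient.rquot_IdomainAxiom | exact: fset_uniq |].
exists (repr y); rewrite -quot_pi_eq0 rmorphB rmorphM rmorph1 /= reprK ay1.
by rewrite subrr.
Qed.

Lemma ideal_norm_gt1 : (1 < ideal_norm P)%N.
Proof.
apply: (@uniq_leq_size _ [:: 0; 1 : {ideal_quot P}]) => [|y _]; last exact: s_full.
by rewrite /= inE eq_sym oner_neq0.
Qed.

(* The |A/P| residues of A already exhaust the roots of X^N(P) - X in B/Q. *)
Lemma mem_residue_of_expf (B : comNzRingType) (f : {rmorphism R -> B})
    (Q : prime_idealr B) (QP : forall a, (f a \in Q) = (a \in P)) (b : B) :
  b ^+ ideal_norm P - b \in Q -> exists a, b - f a \in Q.
Proof.
move=> bQ; apply: contrapT => nob; pose F (x : {ideal_quot P}) := \pi_{ideal_quot Q} (f (repr x)).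
have F_inj : {in s &, injective F}.
  move=> x y _ _ /eqP; rewrite -subr_eq0 -!rmorphB /= quot_pi_eq0 QP.
  by rewrite -quot_pi_eq0 rmorphB /= !reprK subr_eq0 => /eqP.
pose p : {poly {ideal_quot Q}} := 'X^(ideal_norm P) - 'X.
have size_p : size p = (ideal_norm P).+1.
  by rewrite size_polyDl size_polyXn // size_polyN size_polyX ltnS ideal_norm_gt1.
have p0 : p != 0 by rewrite -size_poly_eq0 size_p.
have := @quot_max_poly_roots _ _ p (\pi_{ideal_quot Q} b :: map F s) p0.
rewrite size_p /= size_map ltnn => noroot; suff : false by []; apply: noroot.
  apply/andP; split; first by rewrite rootE !hornerE -rmorphXn -rmorphB quot_pi_eq0.
  apply/allP=> _ /mapP[x _ ->]; rewrite rootE !hornerE -!rmorphXn -!rmorphB /=.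
  by rewrite quot_pi_eq0 QP quot_expf_norm.
rewrite map_inj_in_uniq // fset_uniq andbT; apply/negP=> /mapP[x _ Dx].
by apply: nob; exists (repr x); rewrite -quot_pi_eq0 rmorphB subr_eq0; apply/eqP.
Qed.

End IdealNorm.

Lemma root_algint_val (L : fieldType) (q : {poly int}) (x : ringOfInt L) :
  root (map_poly intr q) (val x) = root (map_poly intr q) x.
Proof.
pose iota : {rmorphism ringOfInt L -> L} := val.
have iotaZ : iota \o intr =1 intr by move=> z; apply: (rmorph_int iota).
rewrite -(eq_map_poly iotaZ) map_poly_comp !rootE -[val x]/(iota x) horner_map.
by rewrite -[0 in LHS](rmorph0 iota) (inj_eq val_inj).
Qed.

(** * Finiteness of the residue field of a nonzero prime *)

Section ResidueField.
Variables (K : fieldExtType rat) (P : prime_idealr (ringOfInt K)).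
Hypothesis P_neq0 : exists2 x, x \in P & x != 0.

(** Strip all factors X from an integer polynomial vanishing at a nonzero [x] of [P]: the constant
    term is then nonzero and a multiple of [x]. *)
Lemma int_in_prime : exists2 m : int, m != 0 & m%:~R \in P.
Proof.
have [x xP x0] := P_neq0.
have /asboolP[q q_monic qx0] : \val x \in @is_algint K by case: (x).
have [k [r /implyP r0 Dq]] := multiplicity_XsubC q 0.
have {}r0 := r0 (monic_neq0 q_monic); exists r.[0]; first exact: r0.
have rx0 : (map_poly intr r).[x] = 0.
  have vx0 : val x != 0 :> K.
    by apply: contraNneq x0 => vx0; apply/eqP/val_inj; rewrite vx0.
  apply/rootP; rewrite -root_algint_val; move: qx0.
  rewrite Dq subr0 rmorphM rmorphXn /= map_polyX !rootE hornerM hornerXn mulf_eq0.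
  by rewrite expf_eq0 (negbTE vx0) andbF orbF.
have /factor_theorem[u Du] : root (map_poly intr r - (r.[0]%:~R)%:P) (0 : ringOfInt K).
  by rewrite rootE !hornerE -[0 in X in X - _](rmorph0 intr) horner_map subrr.
have := congr1 (horner^~ x) Du; rewrite !hornerE rx0 sub0r.
by move/(canRL opprK) ->; rewrite rpredN subr0 idealMr.
Qed.

Lemma prime_in_prime : exists2 p : nat, prime p & p%:R \in P.
Proof.
have [m m0 mP] := int_in_prime.
have : `|m|%N%:R \in P.
  by case: m {m0} mP => n //; rewrite NegzE mulrNz rpredN.
rewrite -absz_eq0 -lt0n in m0.
elim/ltn_ind: `|m|%N m0 => {m mP} n IHn n_gt0 nP.
have n_gt1 : (1 < n)%N.
  by case: n n_gt0 nP {IHn} => [|[|]] //; rewrite idealr1.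
move: nP; rewrite -(divnK (pdiv_dvd n)) natrM prime_idealrM => /orP[|pP].
  by apply: IHn; rewrite ?ltn_Pdiv ?prime_gt1 ?pdiv_prime ?divn_gt0 ?pdiv_gt0 ?pdiv_leq.
by exists (pdiv n) => //; apply: pdiv_prime.
Qed.

(** Clear denominators in the minimal polynomial over the rationals and divide by the content.
    Primitivity keeps the result nonzero modulo every rational prime, and the size bound is uniform
    in [x]. *)
Lemma primitive_annihilator (x : K) : exists q : {poly int},
  [/\ zcontents q = 1, (size q <= (\dim {:K}).+1)%N & root (map_poly intr q) x].
Proof.
have /polyOver1P[r Dr] := minPolyOver 1%VS x.
have [q [a a0 Da]] := rat_poly_scale r.
have r0 : r != 0.
  by rewrite -(map_poly_eq0 (in_alg K)) -Dr monic_neq0 ?monic_minPoly.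
have q0 : q != 0 by apply: contraNneq r0 => q0; rewrite Da q0 rmorph0 scaler0.
have size_q : size q = size (minPoly 1%VS x).
  rewrite Dr size_map_poly Da size_scale ?invr_eq0 ?intr_eq0 //.
  by rewrite size_map_poly_id0 // intr_eq0 lead_coef_eq0.
exists (zprimitive q); split; first by rewrite zcontents_primitive q0.
  rewrite size_zprimitive size_q size_minPoly ltnS.
  by have := dim_Fadjoin 1%AS x; rewrite dimv1 muln1 => <-; apply/dimvS/subvf.
have : root (map_poly (in_alg K) r) x by rewrite -Dr root_minPoly.
have algZ : in_alg K \o intr =1 intr by move=> z; apply: (rmorph_int (in_alg K)).
rewrite Da map_polyZ rootZ ?fmorph_eq0 ?invr_eq0 ?intr_eq0 //.
rewrite -map_poly_comp (eq_map_poly algZ) [q in map_poly _ q]zpolyEprim map_polyZ.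
by rewrite rootZ //= -(rmorph_int (in_alg K)) fmorph_eq0 intr_eq0 zcontents_eq0.
Qed.

Lemma finite_roots (R : comNzRingType) (Q : prime_idealr R) (p : {poly {ideal_quot Q}}) :
  p != 0 -> finite_set [set x | root p x]%classic.
Proof.
move=> p0; apply: contrapT => /(infinite_set_fset (size p))[s sp].
rewrite leqNgt => /negP; apply; apply: quot_max_poly_roots (fset_uniq s) => //.
by apply/allP=> x /sp.
Qed.

(* Every residue is a root of one of the finitely many nonzero polynomials of
   degree at most [K : Q] over F_p. *)
Lemma residue_field_finite : finite_set [set: {ideal_quot P}]%classic.
Proof.
have [p p_pr pP] := prime_in_prime.
pose n := \dim {:K}.
have pq0 : p%:R = 0 :> {ideal_quot P}.
  by apply/eqP; rewrite -(rmorph_nat (\pi_{ideal_quot P})) quot_pi_eq0.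
pose poly_of (v : {ffun 'I_n.+1 -> 'I_p}) : {poly {ideal_quot P}} :=
  \poly_(i < n.+1) (v (inord i))%:R.
apply: (@sub_finite_set _ _
  (\bigcup_(v in [set v | poly_of v != 0]) [set x | root (poly_of v) x]))%classic;
  last first.
  by apply: bigcup_finite => // v /finite_roots.
move=> x _; have [q [q1 sz_q q_root]] := primitive_annihilator (\val (repr x)).
have p_gt0 := prime_gt0 p_pr.
have p_neq0 : p%:Z != 0 by rewrite -lt0n.
have lt_p (i : 'I_n.+1) : (`|(q`_i %% p)%Z| < p)%N.
  by rewrite -ltz_nat gez0_abs ?ltz_pmod ?modz_ge0.
pose v := [ffun i => Ordinal (lt_p i)].
have Dv : poly_of v = map_poly intr q.
  apply/polyP=> i; rewrite coef_poly coef_map /=; case: ltnP => [lt_in | le_ni].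
    rewrite ffunE /= inordK // pmulrn gez0_abs ?modz_ge0 //.
    rewrite [in RHS](divz_eq q`_i p) [RHS]intrD [X in _ = X + _]intrM -[p%:~R]pmulrn pq0.
    by rewrite mulr0 add0r.
  by rewrite (nth_default 0 (leq_trans sz_q le_ni)).
exists v => /=; rewrite Dv.
  (* A vanishing reduction would put all coefficients of [q] in [P]; by Bezout they would be
     multiples of [p], against content 1. *)
  apply/negP=> /eqP q0; have : (p%:Z %| zcontents q)%Z.
    rewrite dvdz_contents; apply/polyOverP => i.
    have qi0 : (q`_i)%:~R \in P.
      rewrite -quot_pi_eq0 rmorph_int; apply/eqP.
      by rewrite -[X in X = _](coef_map intr) q0 coef0.
    apply/negPn/negP => pNq.
    have /coprimezP[[a b] /= ab1] : coprimez p q`_i.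
      by rewrite coprimezE prime_coprime // -dvdzE.
    have : 1 \in P.
      by rewrite -[1]/(1%:~R) -ab1 intrD !intrM rpredD ?idealMr.
    by rewrite idealr1.
  by rewrite q1 dvdzE /= dvdn1; case: (p) p_pr => [|[|]].
rewrite -[x]reprK rootE.
rewrite -(eq_map_poly (rmorph_int (\pi_{ideal_quot P}))) map_poly_comp horner_map.
by move: q_root; rewrite root_algint_val => /rootP ->; rewrite rmorph0.
Qed.

End ResidueField.

(** * Polynomials modulo a prime *)

Lemma prod_XsubC_double_root (R : comNzRingType) (ys : seq R) : ~~ uniq ys ->
  exists y q, \prod_(z <- ys) ('X - z%:P) = ('X - y%:P) ^+ 2 * q.
Proof.
elim: ys => //= y ys IHys; rewrite negb_and negbK big_cons => /orP[y_ys | /IHys].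
  exists y, (\prod_(z <- rem y ys) ('X - z%:P)).
  by rewrite (perm_big _ (perm_to_rem y_ys)) big_cons expr2 mulrA.
by case=> z [q ->]; exists z, (('X - y%:P) * q); rewrite mulrCA.
Qed.

Section PolyMod.
Variables (A B : comNzRingType) (f : {rmorphism A -> B}).
Variables (P : prime_idealr A) (Q : prime_idealr B).
Hypothesis QP : forall a, (f a \in Q) = (a \in P).
Variables (C : {poly A}) (rs : seq B).
Hypothesis C_monic : C \is monic.
Hypothesis C_deg : (2 <= (size C).-1)%N.
Hypothesis C_roots : map_poly f C = \prod_(x <- rs) ('X - x%:P).

Let pf : {rmorphism A -> {ideal_quot Q}} := \pi_{ideal_quot Q} \o f.

Let pf_eq0 a : (pf a == 0) = (a \in P).
Proof. by rewrite /pf /= quot_pi_eq0 QP. Qed.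

Let ys : seq {ideal_quot Q} := map \pi_{ideal_quot Q} rs.

Let C_pf : map_poly pf C = \prod_(y <- ys) ('X - y%:P).
Proof.
rewrite map_poly_comp C_roots rmorph_prod big_map; apply: eq_bigr => x _.
by rewrite rmorphB /= map_polyX map_polyC.
Qed.

(** A double root modulo [Q] is a common root of [C] and its derivative, hence kills the resultant,
    which is a combination of the two. *)
Lemma uniq_roots_mod_disc :
  (1 < size C^`())%N -> poly_disc C \notin P -> uniq ys.
Proof.
move=> C'_deg; apply: contraNT => /prod_XsubC_double_root[y [q Dq]].
rewrite /poly_disc idealMr //.
have C_deg1 : (1 < size C)%N by case: (size C) C_deg => [|[|]].
have [[u v] /= _ uv] := resultant_in_ideal C_deg1 C'_deg.
have Cy : (map_poly pf C).[y] = 0.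
  by rewrite C_pf Dq expr2 -mulrA hornerM hornerXsubC subrr mul0r.
have C'y : (map_poly pf C^`()).[y] = 0.
  rewrite -deriv_map C_pf Dq expr2 -mulrA derivM derivXsubC mul1r hornerD.
  by rewrite !hornerM hornerXsubC subrr !mul0r addr0.
have := congr1 (fun p => (map_poly pf p).[y]) uv => /eqP.
by rewrite map_polyC hornerC rmorphD !rmorphM hornerD !hornerM Cy C'y !mulr0 addr0 pf_eq0.
Qed.

Let size_ys : size ys = (size C).-1.
Proof.
rewrite size_map -[(size C)](size_map_poly_id0 (f := f)) ?C_roots ?size_prod_XsubC //.
by rewrite (monicP C_monic) rmorph1 oner_neq0.
Qed.

Let rem_pf n y : y \in ys -> (map_poly pf (X_pow_rem C n)).[y] = y ^+ n.
Proof.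
move=> y_ys; have := Pdiv.RingMonic.rdivp_eq C_monic 'X^n.
move/(congr1 (fun p => (map_poly pf p).[y])) => /=.
rewrite map_polyXn hornerXn rmorphD rmorphM /= hornerD hornerM => ->.
rewrite C_pf (perm_big _ (perm_to_rem y_ys)) big_cons hornerM hornerXsubC.
by rewrite subrr mul0r mulr0 add0r.
Qed.

(** At a root of [C] the remainder takes the value of [X^n]. Since [R_n - X] has degree less than
    [d], by [d >= 2], it vanishes modulo [P] once it vanishes at the [d] distinct roots modulo
    [Q]. *)
Lemma X_pow_rem_cong n : uniq ys ->
  poly_cong P (X_pow_rem C n) 'X <-> (forall x, x \in rs -> x ^+ n - x \in Q).
Proof.
move=> ys_uniq; split=> [RX x x_rs | xn i].
  have y_ys : \pi_{ideal_quot Q} x \in ys by apply: map_f.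
  rewrite -quot_pi_eq0 rmorphB rmorphXn /= subr_eq0 -(rem_pf n y_ys).
  have -> : map_poly pf (X_pow_rem C n) = 'X; last by rewrite hornerX.
  rewrite -(map_polyX pf); apply/eqP; rewrite -subr_eq0 -rmorphB; apply/eqP/polyP=> i.
  by rewrite coef_map coef0; apply/eqP; rewrite pf_eq0 RX.
rewrite -pf_eq0 -coef_map; set p := map_poly _ _.
have [-> | p0] := eqVneq p 0; first by rewrite coef0.
have : (size ys < size p)%N.
  apply: quot_max_poly_roots => //; apply/allP=> y y_ys; rewrite rootE /p rmorphB /=.
  rewrite map_polyX !hornerE rem_pf //; have /mapP[x x_rs ->] := y_ys.
  by rewrite -rmorphXn -rmorphB quot_pi_eq0 xn.
rewrite ltnNge size_ys; case/negP.
apply: leq_trans (size_poly _ _) _; rewrite -ltnS prednK ?size_poly_gt0 ?monic_neq0 //.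
apply: leq_ltn_trans (size_polyD _ _) _; rewrite size_polyN size_polyX gtn_max.
rewrite Pdiv.Ring.ltn_rmodp monic_neq0 //=.
by case: (size C) C_deg => [|[|[|]]].
Qed.

End PolyMod.

(** * Rings of integers in a Galois extension *)

Section AlgintIncl.
Variables (K : fieldType) (E : fieldExtType K).

Fact algint_incl_zmod_morphism : zmod_morphism (@algint_incl K E).
Proof. by move=> x y; apply: val_inj; apply: (rmorphB (in_alg E)). Qed.

Fact algint_incl_monoid_morphism : monoid_morphism (@algint_incl K E).
Proof.
split=> [|x y]; apply: val_inj; first exact: (rmorph1 (in_alg E)).
exact: (rmorphM (in_alg E)).
Qed.

HB.instance Definition _ := GRing.isZmodMorphism.Build _ _ (@algint_incl K E)
  algint_incl_zmod_morphism.
HB.instance Definition _ := GRing.isMonoidMorphism.Build _ _ (@algint_incl K E)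
  algint_incl_monoid_morphism.

Lemma algint_incl_inj : injective (@algint_incl K E).
Proof.
move=> x y /(congr1 val) /= /(fmorph_inj (in_alg E)) xy.
exact: val_inj.
Qed.

Lemma algint_poly_inclE (p : {poly ringOfInt K}) :
  algint_poly_incl E p = map_poly val (map_poly (algint_incl E) p).
Proof. by rewrite -map_poly_comp. Qed.

Lemma integral_in_alg (k : K) : k%:A \in @is_algint E -> k \in @is_algint K.
Proof.
move=> /asboolP[p p_monic pk0]; apply/asboolP; exists p => //.
have algZ : in_alg E \o intr =1 intr by move=> z; apply: (rmorph_int (in_alg E)).
by move: pk0; rewrite -(eq_map_poly algZ) map_poly_comp fmorph_root.
Qed.

End AlgintIncl.

Lemma map_algint_val_inj (L : fieldType) :
  injective (map_poly (val : ringOfInt L -> L)).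
Proof.
move=> p q pq; apply/polyP=> i; apply: val_inj.
by rewrite -!(coef_map (val : {rmorphism ringOfInt L -> L})) pq.
Qed.

Section GaloisAction.
Variables (K : fieldType) (E : splittingFieldType K).

Fact algint_gal_subproof (s : gal_of {:E}) (x : ringOfInt E) :
  s (\val x) \in @is_algint E.
Proof.
case: x => x /= /asboolP[p p_monic px0]; apply/asboolP; exists p => //.
have sZ : s \o intr =1 intr by move=> z; apply: (rmorph_int s).
by rewrite -(eq_map_poly sZ) map_poly_comp rmorph_root.
Qed.

Definition algint_gal s (x : ringOfInt E) : ringOfInt E :=
  RingOfInt (algint_gal_subproof s x).

Variable s : gal_of {:E}.

Fact algint_gal_zmod_morphism : zmod_morphism (algint_gal s).
Proof. by move=> x y; apply: val_inj; apply: (rmorphB s). Qed.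

Fact algint_gal_monoid_morphism : monoid_morphism (algint_gal s).
Proof.
by split=> [|x y]; apply: val_inj; [apply: (rmorph1 s) | apply: (rmorphM s)].
Qed.

HB.instance Definition _ := GRing.isZmodMorphism.Build _ _ (algint_gal s)
  algint_gal_zmod_morphism.
HB.instance Definition _ := GRing.isMonoidMorphism.Build _ _ (algint_gal s)
  algint_gal_monoid_morphism.

End GaloisAction.

Section GaloisFacts.
Variables (K : fieldType) (E : splittingFieldType K).

Lemma algint_gal1 b : algint_gal (1%g : gal_of {:E}) b = b.
Proof. by apply: val_inj; apply: gal_id. Qed.

Lemma algint_galM (s t : gal_of {:E}) b :
  algint_gal (s * t)%g b = algint_gal t (algint_gal s b).
Proof. by apply: val_inj; rewrite /= galM ?memvf. Qed.

Lemma algint_gal_incl (s : gal_of {:E}) a : algint_gal s (algint_incl E a) = algint_incl E a.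
Proof. by apply: val_inj; rewrite /= linearZ /= rmorph1. Qed.

Lemma gal_full : 'Gal({:E} / 1)%g = [set: gal_of {:E}].
Proof. by apply/setP=> s; rewrite inE gal_kHom ?sub1v // k1AHom. Qed.

Hypothesis galE : galois 1%VS {:E}.

Lemma card_gal_of : #|{: gal_of {:E}}| = \dim {:E}.
Proof. by rewrite -cardsT -gal_full -galois_dim // dimv1 divn1. Qed.

Lemma algint_gal_fixed b :
  (forall s : gal_of {:E}, algint_gal s b = b) -> exists a, b = algint_incl E a.
Proof.
move=> b_fix; have : val b \in fixedField 'Gal({:E} / 1)%g.
  by apply/fixedFieldP=> [|s _]; rewrite ?memvf // -[in RHS](b_fix s).
rewrite (galois_fixedField galE) => /vlineP[k Dk].
have kP : k \in @is_algint K.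
  have bP : val b \in @is_algint E by case: (b).
  by rewrite Dk in bP; apply: integral_in_alg bP.
by exists (RingOfInt kP); apply: val_inj.
Qed.

Lemma gal_eq1_gen (rs : seq E) (s : gal_of {:E}) :
  <<1 & rs>>%VS = {:E}%VS -> {in rs, forall x, s x = x} -> s = 1%g.
Proof.
move=> rs_gen s_rs; apply/eqP/gal_eqP => x _; rewrite gal_id.
have /subvP/(_ x) : (<<1 & rs>> <= fixedField [set s])%VS.
  apply/Fadjoin_seqP; split=> [|y /s_rs sy]; first exact: sub1v.
  by apply/fixedFieldP=> [|t /set1P ->]; rewrite ?memvf.
rewrite rs_gen memvf => /(_ isT)/fixedFieldP; apply; rewrite ?memvf //.
exact: set11.
Qed.

End GaloisFacts.

(** The leading coefficient becomes the degree, nonzero in characteristic 0. The bound serves to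
    write the resultant as a combination of [C] and its derivative. *)
Lemma size_deriv_gt1 (R : comNzRingType) (p : {poly R}) :
  p \is monic -> (forall n, n.+1%:R != 0 :> R) -> (2 < size p)%N ->
  (1 < size p^`())%N.
Proof.
move=> p_monic char0 p_deg; rewrite ltnNge; apply/negP=> /leq_sizeP/(_ (size p).-2).
rewrite coef_deriv; case Dn: (size p) p_deg => [|[|[|n]]] // _ /(_ isT) /eqP.
have := monicP p_monic; rewrite /lead_coef Dn /= => ->.
by rewrite (negbTE (char0 _)).
Qed.

Lemma ideal_prod_sub (R : comNzRingType) n (I : 'I_n -> prime_idealr R) i x :
  ideal_prod (fun j => [set y | y \in I j]%classic) x -> x \in I i.
Proof.
apply: ideal_gen_sub => _ [y [yI ->]].
by rewrite (bigD1 i) //= mulrC idealMr //; apply: yI.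
Qed.

Lemma uniq_map_inj (T U : eqType) (g : T -> U) (s : seq T) :
  uniq (map g s) -> {in s &, injective g}.
Proof.
elim: s => //= z s IHs /andP[gz_s /IHs gI] x y; rewrite !inE.
case/predU1P=> [->|x_s] /predU1P[->|y_s] // gxy; last exact: gI.
  by rewrite gxy map_f in gz_s.
by rewrite -gxy map_f in gz_s.
Qed.

(** * Total splitting and trivial stabilizers *)

Section Splitting.
Variables (K : fieldExtType rat) (E : splittingFieldType K).
Hypothesis galE : galois 1%VS {:E}.
Variable P : prime_idealr (ringOfInt K).
Hypothesis P_max : forall a, a \notin P -> exists a', a * a' - 1 \in P.

Let f : {rmorphism ringOfInt K -> ringOfInt E} := algint_incl E.
Let act (s : gal_of {:E}) : {rmorphism ringOfInt E -> ringOfInt E} := algint_gal s.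
Let act1 : forall b, act 1%g b = b := @algint_gal1 K E.
Let actM : forall s t b, act (s * t)%g b = act t (act s b) := @algint_galM K E.
Let act_f : forall s a, act s (f a) = f a := @algint_gal_incl K E.
Let act_fixed := algint_gal_fixed galE.

(** All the factors lie over [P], hence are conjugates of one of them, [Q0]. There are as many
    distinct factors as automorphisms, so [g] is a bijection and an automorphism preserving [Q0] is
    trivial. *)
Lemma totally_split_stab : totally_split E P ->
  exists Q : prime_idealr (ringOfInt E),
    (forall a, (f a \in Q) = (a \in P)) /\
    (forall s, (forall x, x \in Q -> act s x \in Q) -> s = 1%g).
Proof.
case=> Q [Q_dist PQ].
have QP i a : (f a \in Q i) = (a \in P).
  have fP b : b \in P -> f b \in Q i.
    move=> bP; apply: ideal_prod_sub; rewrite -PQ; apply: ideal_gen_incl.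
    by exists b.
  apply/idP/idP=> [fa | /fP //]; apply/negPn/negP => /P_max[a' aa'].
  have : 1 \in Q i.
    have -> : 1 = f a * f a' - f (a * a' - 1).
      by rewrite rmorphB rmorphM rmorph1 /= subKr.
    by rewrite rpredB ?fP // mulrC idealMr.
  by rewrite idealr1.
have dim_gt0 : (0 < \dim {:E})%N by rewrite adim_gt0.
pose Q0 := Q (Ordinal dim_gt0); exists Q0; split=> [a | s sQ]; first exact: QP.
have /choice[g gQ] i : exists g, forall x, (x \in Q i) = (act g x \in Q0).
  exact: (primes_over_conj act1 actM act_fixed (QP _) (QP i)).
have g_inj : injective g.
  move=> i j gij; apply/eqP/negPn/negP => /Q_dist; apply=> x.
  by rewrite (gQ i) (gQ j) gij.
have g_bij : bijective g by apply: inj_card_bij; rewrite // card_ord card_gal_of.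
have [gi giK gK] := g_bij.
suff /(congr1 g) : gi s = gi 1%g by rewrite !gK.
apply/eqP/negPn/negP => /Q_dist; apply=> x.
by rewrite (gQ (gi s)) (gQ (gi _)) !gK act1 (act_sub_eq act1 actM sQ).
Qed.

(** Both [PB] and the product of the conjugates of [Q] equal the intersection of these conjugates,
    which are distinct because the stabilizer is trivial. *)
Lemma stab_totally_split (Q : prime_idealr (ringOfInt E)) :
    (forall a, (f a \in Q) = (a \in P)) ->
    (forall s, (forall x, x \in Q -> act s x \in Q) -> s = 1%g) ->
  totally_split E P.
Proof.
move=> QP stabQ.
pose h (i : 'I_(\dim {:E})) : gal_of {:E} :=
  enum_val (cast_ord (esym (card_gal_of galE)) i).
have h_bij : bijective h.
  apply: bij_comp; first exact: enum_val_bij.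
  by exists (cast_ord (card_gal_of galE)) => i; rewrite (cast_ordK, cast_ordKV).
have [hi hK hiK] := h_bij.
have /choice[Qs QsE] i : exists Qi : prime_idealr (ringOfInt E),
    forall x, (x \in Qi) = (act (h i) x \in Q).
  have [||Qi QiE] := @prime_idealr_of_pred _ (fun x => act (h i) x \in Q).
  - split; rewrite -?topredE /= ?rmorph0 ?idealr0 ?rmorph1 ?idealr1 //.
    move=> a u v; rewrite -!topredE /= => uQ vQ.
    by rewrite rmorphD rmorphM rpredD ?idealMr.
  - by move=> u v; rewrite -!topredE /= rmorphM prime_idealrM.
  by exists Qi.
have QsT x : (forall i, x \in Qs i) -> forall s, act s x \in Q.
  by move=> xQ s; rewrite -(hiK s) -QsE.
have conjE : (fun i => [set x | x \in Qs i]%classic)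
           = (fun i => [set x | act (h i) x \in Q]%classic).
  apply/funext=> i; apply/seteqP.
  by split=> x /=; rewrite QsE.
exists Qs; split=> [i j /negP ij Qij |].
  apply: ij; suff /stabQ/eqP : forall x, x \in Q -> act ((h i)^-1 * h j)%g x \in Q.
    by rewrite -eq_mulVg1 => /eqP/(can_inj hK)->.
  by move=> x xQ; rewrite actM -QsE -Qij QsE -actM mulVg act1.
apply/seteqP; split=> x xI.
  rewrite conjE; apply: (orbit_sub_ideal_prod act1 actM act_f act_fixed P_max QP) => //.
  apply: QsT => i; apply: ideal_gen_sub xI => _ [a aP <-].
  by rewrite QsE act_f QP.
apply: (orbit_sub_ideal_ext act1 actM act_fixed P_max QP stabQ h_bij).
by apply: QsT => i; apply: ideal_prod_sub xI.
Qed.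

End Splitting.

(** * Roots of [C] and the splitting criterion *)

Lemma algint_roots (K : fieldType) (E : fieldExtType K) (C : {poly ringOfInt K})
    (rs : seq E) :
  C \is monic -> algint_poly_incl E C %= \prod_(z <- rs) ('X - z%:P) ->
  exists2 rs' : seq (ringOfInt E), rs = map val rs'
    & map_poly (algint_incl E) C = \prod_(z <- rs') ('X - z%:P).
Proof.
move=> C_monic; have CE_monic : algint_poly_incl E C \is monic.
  rewrite algint_poly_inclE; apply: (monic_map (val : {rmorphism ringOfInt E -> E})).
  exact: monic_map.
rewrite eqp_monic ?monic_prod_XsubC // => /eqP CE.
(* Roots of a monic polynomial with integral coefficients are integral. *)
have : {subset rs <= @is_algint E}.
  move=> x x_rs; apply/asboolP.
  apply: (integral_root_monic (RtoK := intr) CE_monic).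
    by rewrite CE root_prod_XsubC.
  apply/integral_poly => i; rewrite algint_poly_inclE coef_map.
  by case: (_`_i) => y /= /asboolP.
move=> rs_int; have [rs' Drs] : exists rs' : seq (ringOfInt E), rs = map val rs'.
  elim: rs rs_int {CE} => [|x rs IHrs] rs_int; first by exists [::].
  have [|rs' ->] := IHrs; first by move=> y y_rs; rewrite rs_int ?inE ?y_rs ?orbT.
  by exists (RingOfInt (rs_int x (mem_head _ _)) :: rs').
exists rs' => //; apply: map_algint_val_inj; rewrite -algint_poly_inclE CE Drs.
pose iota : {rmorphism ringOfInt E -> E} := val.
rewrite big_map; exact/esym/(map_prod_XsubC iota).
Qed.

Theorem theorem15 (K : fieldExtType rat) (E : splittingFieldType K)
    (galE : galois 1%VS {:E})
    (C : {poly ringOfInt K})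
    (C_monic : C \is monic)
    (C_deg : (2 <= (size C).-1)%N)
    (C_simple : forall z : E, root (algint_poly_incl E C) z ->
                  mup z (algint_poly_incl E C) = 1%N)
    (C_split : splittingFieldFor 1%VS (algint_poly_incl E C) {:E})
    (P : prime_idealr (ringOfInt K))
    (P_neq0 : exists2 x, x \in P & x != 0)
    (P_unram : poly_disc C \notin P) :
  totally_split E P <-> poly_cong P (X_pow_rem C (ideal_norm P)) 'X.
Proof.
have P_fin := residue_field_finite P_neq0; have P_max := quot_field P_fin.
have [_ /(algint_roots C_monic)[rs -> C_rs] rs_gen] := C_split.
have C'_deg : (1 < size C^`())%N.
  apply: size_deriv_gt1 => // [n|]; last by case: (size C) C_deg => [|[|[|]]].
  apply/negP=> /eqP/(congr1 val)/eqP.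
  rewrite (rmorph_nat (val : {rmorphism ringOfInt K -> K})).
  by rewrite -(rmorph_nat (in_alg K)) fmorph_eq0 Num.Theory.pnatr_eq0.
pose iota : {rmorphism ringOfInt E -> E} := val.
have remP (Q : prime_idealr (ringOfInt E))
    (QP : forall a, (algint_incl E a \in Q) = (a \in P)) :=
  X_pow_rem_cong QP C_monic C_deg C_rs (ideal_norm P)
    (uniq_roots_mod_disc QP C_deg C_rs C'_deg P_unram).
split=> [/(totally_split_stab galE P_max)[Q [QP stabQ]] | RX].
  apply/(remP Q QP) => x x_rs.
  (* The trivial stabilizer gives [A/P = B/Q]: each root is congruent to some [a] of [A], which is
     its own power of exponent [N(P)] modulo [P]. *)
  have [a xa] := residue_lift (@algint_gal1 K E) (@algint_galM K E)
    (algint_gal_fixed galE) P_max QP stabQ x.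
  rewrite -quot_pi_eq0 rmorphB rmorphXn /=.
  have /eqP -> : \pi_{ideal_quot Q} x == \pi_{ideal_quot Q} (algint_incl E a).
    by rewrite -Quotient.idealrBE.
  by rewrite -rmorphXn -rmorphB quot_pi_eq0 -rmorphXn -rmorphB QP quot_expf_norm.
have [Q QP] := lying_over (@algint_gal1 K E) (@algint_galM K E)
  (algint_gal_fixed galE) P (@algint_incl_inj K E).
apply: (stab_totally_split galE P_max QP) => s sQ.
have rs_uniq := uniq_roots_mod_disc QP C_deg C_rs C'_deg P_unram.
apply: gal_eq1_gen rs_gen _ => _ /mapP[x x_rs ->].
(* The root [x] is congruent to some [a] of [A]; as [s] fixes [a] and preserves [Q], [s x] is
   congruent to [x], and roots congruent modulo [Q] are equal. *)
have [a xa] := mem_residue_of_expf P_fin QP ((remP Q QP).1 RX x x_rs).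
have sx_rs : algint_gal s x \in rs.
  have Cx : (map_poly (algint_incl E) C).[x] = 0.
    by rewrite C_rs (perm_big _ (perm_to_rem x_rs)) big_cons !hornerE subrr mul0r.
  have : root (map_poly (algint_incl E) C) (algint_gal s x).
    rewrite -(eq_map_poly (algint_gal_incl s)) map_poly_comp rootE horner_map.
    by rewrite Cx rmorph0.
  (* The roots of the product are read off in the field [E]. *)
  move/(rmorph_root iota); rewrite C_rs map_prod_XsubC.
  rewrite -(big_map iota xpredT (fun z => 'X - z%:P)) root_prod_XsubC mem_map //.
  exact: val_inj.
suff /(congr1 val) : algint_gal s x = x by [].
apply: (uniq_map_inj rs_uniq) => //; apply/eqP; rewrite -Quotient.idealrBE.
have := rpredB (sQ _ xa) xa; rewrite rmorphB /= algint_gal_incl.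
by rewrite opprB addrA subrK.
Qed.
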